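(* Let $M\subset\mathbb N$ be a finite non-empty set, let $(H,h)=\mathrm{Or}(M)$ be the corresponding Orlik block with its monodromy $h$, and let $\mu\in\mathbb N$. If the pair $(M,\mu)$ is sdiOb-sufficient, then $(H,h^\mu)$ admits a standard decomposition into Orlik blocks.
   Context: $\mathbb N=\{1,2,3,\dots\}$; $\Phi_m$ is the $m$-th cyclotomic polynomial. A $\mathbb Z$-lattice is a free $\mathbb Z$-module of finite rank. Orlik blocks: let $H$ be a $\mathbb Z$-lattice of rank $n\in\mathbb N$ and $h:H\to H$ an endomorphism with characteristic polynomial $p_{H,h}$. $(H,h)$ is a companion block if there is $a_0\in H$ with $H=\bigoplus_{j=0}^{n-1}\mathbb Z\cdot h^j(a_0)$; it is an Orlik block if moreover $h$ is an automorphism of finite order. An $h$-invariant sublattice is an Orlik block if it is one with the restriction of $h$. A standard decomposition into Orlik blocks is a decomposition $H=\bigoplus_{i=1}^kH^{(i)}$ into Orlik blocks $H^{(i)}$ (with respect to the given endomorphism) with $p_{H^{(k)},h}\mid p_{H^{(k-1)},h}\mid\dots\mid p_{H^{(1)},h}$. For a finite set $M\subset\mathbb N$ put $p_M:=\prod_{m\in M}\Phi_m$ and $\mathrm{Or}(M):=(\mathbb Z[t]/p_M\mathbb Z[t],\ \text{multiplication by }t)$, which is an Orlik block for $M\ne\emptyset$. $p$-edges: for a prime number $p$ let $E_p:=\{(m,n)\in\mathbb N^2\mid \frac mn=p^k\text{ for some }k\in\mathbb N\}$; its elements are called $p$-edges. For $M\subset\mathbb N$ put $E_p(M):=E_p\cap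 M^2$. For $\mu\in\mathbb N$ define $\gamma_\mu:\mathbb N\to\mathbb N$, $m\mapsto\frac{m}{\gcd(m,\mu)}$. sdiOb-sufficiency: for a finite set $M\subset\mathbb N$ and $\mu\in\mathbb N$, the pair $(M,\mu)$ is sdiOb-sufficient if for every prime number $p$ and every $p$-edge $(n_a,n_b)\in E_p(\gamma_\mu(M))$ at least one of the following two conditions holds: $$E_p\cap\left((\gamma_\mu^{-1}(n_a)\cap M)\times\gamma_\mu^{-1}(n_b)\right)\subset E_p(M),$$ $$E_p\cap\left(\gamma_\mu^{-1}(n_a)\times(\gamma_\mu^{-1}(n_b)\cap M)\right)\subset E_p(M).$$ *)

(* Defs.v *)
From HB Require Import structures.
From mathcomp Require Import all_boot all_order all_algebra.
From mathcomp Require Import qpoly cyclotomic.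
From mathcomp Require Import finmap.
From mathcomp Require Import boolp classical_sets functions.

Set Implicit Arguments.
Unset Strict Implicit.
Unset Printing Implicit Defensive.

Import GRing.Theory.

Local Open Scope classical_set_scope.
Local Open Scope ring_scope.

(* Sublattices are subsets L of an ambient abelian group V, and h is an        *)
(* endomorphism of V; every notion below is about L with the restriction of h. *)
(* The case of the whole lattice is L = setT.                                  *)

Definition zbasis (V : zmodType) (L : set V) (n : nat) (b : 'I_n -> V) : Prop :=
  L = [set \sum_(i < n) b i *~ c i | c in [set: {ffun 'I_n -> int}]] /\
  injective (fun c : {ffun 'I_n -> int} => \sum_(i < n) b i *~ c i).

Definition zlattice (V : zmodType) (L : set V) (n : nat) : Prop :=
  exists b : 'I_n -> V, zbasis L b.

Definition direct_sum (V : zmodType) (L : set V) (k : nat)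
    (Ls : 'I_k -> set V) : Prop :=
  L = [set x | exists2 y : {ffun 'I_k -> V},
                 forall i, Ls i (y i) & x = \sum_(i < k) y i] /\
  (forall y z : {ffun 'I_k -> V},
     (forall i, Ls i (y i)) -> (forall i, Ls i (z i)) ->
     \sum_(i < k) y i = \sum_(i < k) z i -> y = z).

(* p is the characteristic polynomial p_{L,h}: it does not depend on the basis. *)
Definition lattice_char_poly (V : zmodType) (L : set V) (h : {additive V -> V})
    (p : {poly int}) : Prop :=
  exists (n : nat) (b : 'I_n -> V) (A : 'M[int]_n),
    [/\ zbasis L b,
        forall j, h (b j) = \sum_(i < n) b i *~ A i j
      & p = char_poly A].

Definition companion_block (V : zmodType) (L : set V) (h : {additive V -> V}) :
    Prop :=
  exists (n : nat) (a0 : V),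
    [/\ (0 < n)%N, zlattice L n, h @` L `<=` L, L a0
      & direct_sum L
          (fun j : 'I_n => [set iter j h a0 *~ c | c in [set: int]])].

Definition orlik_block (V : zmodType) (L : set V) (h : {additive V -> V}) :
    Prop :=
  [/\ companion_block L h, set_bij L L h
    & exists2 m : nat, (0 < m)%N & forall x, L x -> iter m h x = x].

Definition standard_orlik_decomposition (V : zmodType) (h : {additive V -> V})
    (k : nat) (Ls : 'I_k -> set V) : Prop :=
  [/\ direct_sum [set: V] Ls,
      forall i, orlik_block (Ls i) h
    & exists2 p : 'I_k -> {poly int},
        forall i, lattice_char_poly (Ls i) h (p i)
      & forall i j : 'I_k, j = i.+1 :> nat ->
          exists q : {poly int}, p i = q * p j].

Definition has_standard_orlik_decomposition (V : zmodType)
    (h : {additive V -> V}) : Prop :=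
  exists (k : nat) (Ls : 'I_k -> set V), standard_orlik_decomposition h Ls.

Section IterAdditive.
Variables (V : zmodType) (h : {additive V -> V}) (n : nat).

Fact iter_is_zmod_morphism : zmod_morphism (iter n h).
Proof. by move=> x y; elim: n => //= m ->; rewrite raddfB. Qed.

HB.instance Definition _ :=
  GRing.isZmodMorphism.Build V V (iter n h) iter_is_zmod_morphism.

End IterAdditive.

Definition cyclotomic_prod (M : {fset nat}) : {poly int} :=
  \prod_(m <- M) 'Phi_m.

(* {poly %/ p} is Z[t]/(p) only for p monic and nonconstant, i.e. here for M    *)
(* containing a positive integer; otherwise MathComp replaces p by 'X.          *)
Definition Or (M : {fset nat}) : comNzRingType := {poly %/ cyclotomic_prod M}.

Definition Or_monodromy (M : {fset nat}) (x : Or M) : Or M := 'qX * x.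

Fact Or_monodromy_is_zmod_morphism (M : {fset nat}) :
  zmod_morphism (@Or_monodromy M).
Proof. by move=> x y; rewrite /Or_monodromy mulrBr. Qed.

HB.instance Definition _ (M : {fset nat}) :=
  GRing.isZmodMorphism.Build (Or M) (Or M) (@Or_monodromy M)
    (@Or_monodromy_is_zmod_morphism M).

Definition p_edges (p : nat) : set (nat * nat) :=
  [set e | [/\ (0 < e.1)%N, (0 < e.2)%N
             & exists2 k : nat, (0 < k)%N & e.1 = (p ^ k * e.2)%N]].

Definition p_edges_on (p : nat) (M : set nat) : set (nat * nat) :=
  p_edges p `&` (M `*` M).

Definition gamma (mu m : nat) : nat := (m %/ gcdn m mu)%N.

Definition sdiOb_sufficient (M : {fset nat}) (mu : nat) : Prop :=
  forall p : nat, prime p ->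
  forall na nb : nat, p_edges_on p (gamma mu @` [set` M]) (na, nb) ->
       p_edges p `&` ((gamma mu @^-1` [set na] `&` [set` M])
                        `*` (gamma mu @^-1` [set nb]))
         `<=` p_edges_on p [set` M]
    \/ p_edges p `&` ((gamma mu @^-1` [set na])
                        `*` (gamma mu @^-1` [set nb] `&` [set` M]))
         `<=` p_edges_on p [set` M].

(* Main.v *)
From HB Require Import structures.
Require Import Defs.
From mathcomp Require Import all_boot all_order all_algebra.
From mathcomp Require Import qpoly cyclotomic finmap ring.
From mathcomp Require Import boolp classical_sets functions.

Set Implicit Arguments.
Unset Strict Implicit.
Unset Printing Implicit Defensive.

Import GRing.Theory.

Local Open Scope classical_set_scope.
Local Open Scope ring_scope.

(** Write s = t^mu. Where t acts as a root of unity of order m, s acts as one of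
order gamma mu m, so the lattice H = Z[t]/p_M, seen as a module over Z[s], is
built from the pieces Z[t]/P_n, where P_n is the product
of the Phi_m with m in M and gamma mu m = n. Each piece is free over
Z[s]/Phi_n(s), with basis 1, t, ..., t^(r_n - 1): a root zeta of Phi_m satisfies
over Z[zeta^mu] a monic equation of the least possible degree
([cyclotomic_tower]).

The pieces are glued along the factorisation Phi_n(s) = P_n * Q_n, in which Q_n
is the product of the Phi_m with gamma mu m = n and m not in M
([comp_Xn_Cyclotomic]). Suppose that Q_n is a unit modulo P_n' whenever n' is
different from n and r_n' <= r_n, and split off the pieces in the order of
decreasing r_n. If P' is the product of the pieces that remain after P_n, the
submodule generated by P_n in Z[t]/(P_n P') is generated over Z[s] by the
elements P_n Q_n t^i = Phi_n(s) t^i with i < r_n. By induction H is generated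
over Z[s] by the t^i with i < R, where R is the largest r_n
([powers_span_prod]). The same argument for the pieces with r_n <= k shows that
t^k minus a suitable Z[s]-combination of lower powers, say b_k, is divisible by
those P_n; therefore b_k is killed by p_k(s), where p_k is the product of the
Phi_n with r_n > k ([powers_span_annihilated_basis]). The b_k with k < R still
generate H, and the degrees of the p_k add up to the rank of H, so H is the
direct sum of the modules Z[s] b_k, and Z[s] b_k is isomorphic to Z[s]/p_k
([cyclic_sum_free]). These are Orlik blocks, and p_(k+1) divides p_k.

It remains to see why Q_n is a unit modulo P_n' ([comaximal_fibers]). Two
cyclotomic polynomials are comaximal in Z[t] unless the quotient of their
indices is a power of a prime ([comaximal_Cyclotomic]). If m0 outside M over n
and m1 in M over n' were joined by a p-edge, then so would be n and n', and
sufficiency would say that every p-neighbour over n' of an element of M over n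
is in M, since the other alternative puts m0 into M. Counting the elements of
the two fibers with a given prime-to-p part then yields r_n < r_n'
([fiber_rank_lt]). *)

(** * Big operators over fibers and subsets *)

Lemma big_fibers (R : Type) (idx : R) (op : Monoid.com_law idx)
    (I J : eqType) (r : seq I) (s : seq J) (f : I -> J) (F : I -> R) :
  uniq s -> {in r, forall i, f i \in s} ->
  \big[op/idx]_(i <- r) F i
    = \big[op/idx]_(j <- s) \big[op/idx]_(i <- r | f i == j) F i.
Proof.
move=> s_uniq fs; rewrite (exchange_big_dep predT) //=.
apply: eq_big_seq => i ir; rewrite -big_filter (@eq_filter _ _ (pred1 (f i))).
  by rewrite filter_pred1_uniq ?fs // big_seq1.
by move=> j; rewrite /= eq_sym.
Qed.

Lemma big_mem_sub (R : Type) (idx : R) (op : Monoid.com_law idx) (I : eqType)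
    (s t : seq I) (F : I -> R) : uniq s -> uniq t -> {subset s <= t} ->
  \big[op/idx]_(i <- t | i \in s) F i = \big[op/idx]_(i <- s) F i.
Proof.
move=> s_uniq t_uniq st; rewrite -big_filter; apply/perm_big/uniq_perm => //.
  exact: filter_uniq.
by move=> i; rewrite mem_filter andb_idr // => /st.
Qed.

Lemma size_monic_prod_pred (R : idomainType) (I : Type) (r : seq I) (P : pred I)
    (F : I -> {poly R}) : (forall i, P i -> F i \is monic) ->
  (size (\prod_(i <- r | P i) F i)).-1
    = (\sum_(i <- r | P i) (size (F i)).-1)%N.
Proof.
move=> F_monic; elim: r => [|i r IHr]; first by rewrite !big_nil size_poly1.
rewrite !big_cons; case: ifP => // Pi.
have m1 := F_monic _ Pi; have m2 := monic_prod r F_monic.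
rewrite size_mul ?monic_neq0 // -IHr.
by rewrite (polySpred (monic_neq0 m1)) (polySpred (monic_neq0 m2)) addnS.
Qed.

(** * Divisibility and comaximality *)

(** Divisibility in the ring itself: for integer polynomials the relation %| of
polynomial division only asks for it up to a nonzero constant factor. *)
Definition divides (R : comNzRingType) (a b : R) := exists q, b = q * a.

Section Divides.
Variable R : comNzRingType.
Implicit Types a b c : R.

Lemma divides0 a : divides a 0. Proof. by exists 0; rewrite mul0r. Qed.

Lemma dividesD a b c : divides a b -> divides a c -> divides a (b + c).
Proof. by move=> [q ->] [q' ->]; exists (q + q'); rewrite mulrDl. Qed.

Lemma divides_mull a b c : divides a b -> divides a (c * b).
Proof. by move=> [q ->]; exists (c * q); rewrite mulrA. Qed.

Lemma dividesN a b : divides a b -> divides a (- b).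
Proof. by move=> [q ->]; exists (- q); rewrite mulNr. Qed.

Lemma divides_sum a (I : Type) (r : seq I) (P : pred I) (F : I -> R) :
  (forall i, P i -> divides a (F i)) -> divides a (\sum_(i <- r | P i) F i).
Proof.
by move=> aF; elim/big_ind: _ => //; [exact: divides0 | exact: dividesD].
Qed.

Lemma divides_trans a b c : divides a b -> divides b c -> divides a c.
Proof. by move=> [q ->] [q' ->]; exists (q' * q); rewrite mulrA. Qed.

Lemma divides_mul a b c d : divides a b -> divides c d ->
  divides (a * c) (b * d).
Proof. by move=> [q ->] [q' ->]; exists (q * q'); rewrite mulrACA. Qed.

Lemma divides_prod_seq (I : eqType) (r : seq I) (F : I -> R) i :
  i \in r -> divides (F i) (\prod_(j <- r) F j).
Proof.
elim: r => // j r IHr; rewrite inE big_cons => /predU1P[->|/IHr ir].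
  by exists (\prod_(j <- r) F j); rewrite mulrC.
exact: divides_mull.
Qed.

End Divides.

Definition comaximal (R : comNzRingType) (a b : R) :=
  exists u v, u * a + v * b = 1.

Lemma comaximalC (R : comNzRingType) (a b : R) : comaximal a b -> comaximal b a.
Proof. by case=> u [v uv]; exists v, u; rewrite addrC. Qed.

Lemma comaximalMr (R : comNzRingType) (a b c : R) :
  comaximal a b -> comaximal a c -> comaximal a (b * c).
Proof.
move=> [u [v uv]] [u' [v' uv']].
exists (u * (u' * a + v' * c) + u' * (v * b)), (v * v').
by rewrite -[RHS]mulr1 -{1}uv -uv'; ring.
Qed.

Lemma comaximal_prodr (R : comNzRingType) (a : R) (I : eqType) (r : seq I)
    (P : pred I) (F : I -> R) :
  (forall i, i \in r -> P i -> comaximal a (F i)) ->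
  comaximal a (\prod_(i <- r | P i) F i).
Proof.
move=> aF; rewrite big_seq_cond; elim/big_rec: _ => [|i x].
  by exists 0, 1; rewrite mul0r add0r mulr1.
by move=> /andP[ir Pi] ax; apply: comaximalMr => //; apply: aF.
Qed.

(** * The map gamma and cyclotomic polynomials *)

Lemma gamma_gt0 mu m : (0 < m)%N -> (0 < gamma mu m)%N.
Proof.
by move=> m0; rewrite /gamma divn_gt0 ?gcdn_gt0 ?m0 // dvdn_leq ?dvdn_gcdl.
Qed.

Lemma gammaM mu m : (gamma mu m * gcdn m mu)%N = m.
Proof. by rewrite /gamma divnK // dvdn_gcdl. Qed.

Lemma coprime_gamma mu m : (0 < mu)%N ->
  coprime (gamma mu m) (mu %/ gcdn m mu).
Proof.
move=> mu0; have g0 : (0 < gcdn m mu)%N by rewrite gcdn_gt0 mu0 orbT.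
rewrite /coprime -(eqn_pmul2r g0) mul1n muln_gcdl gammaM divnK //.
exact: dvdn_gcdr.
Qed.

(** If zeta has order m, then zeta^mu has order gamma mu m, and both sides say
that zeta^(mu * n) = 1. *)
Lemma dvdn_gamma mu m n : (0 < mu)%N -> (gamma mu m %| n)%N = (m %| n * mu)%N.
Proof.
move=> mu0; have g0 : (0 < gcdn m mu)%N by rewrite gcdn_gt0 mu0 orbT.
rewrite -[in LHS](Gauss_dvdl n (coprime_gamma m mu0)).
by rewrite -(dvdn_pmul2r g0) gammaM -mulnA divnK ?dvdn_gcdr.
Qed.

Lemma monic_prod_Cyclotomic (I : Type) (r : seq I) (P : pred I) (f : I -> nat) :
  \prod_(i <- r | P i) 'Phi_(f i) \is monic.
Proof. by apply: monic_prod => i _; apply: Cyclotomic_monic. Qed.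

(** Multiplied over the divisors of n, both sides give X^(n * mu) - 1, because
every divisor m of n * mu occurs over the divisor gamma mu m of n. The factors
for the proper divisors of n cancel by induction. *)
Lemma comp_Xn_Cyclotomic mu n : (0 < mu)%N -> (0 < n)%N ->
  'Phi_n \Po 'X^mu
    = \prod_(m <- divisors (n * mu) | gamma mu m == n) 'Phi_m :> {poly int}.
Proof.
move=> mu0; have [k] := ubnP n; elim: k n => // k IHk n; rewrite ltnS.
move=> le_nk n0.
have nmu0 : (0 < n * mu)%N by rewrite muln_gt0 n0.
pose A d : {poly int} :=
  \prod_(m <- divisors (n * mu) | gamma mu m == d) 'Phi_m.
have EA : \prod_(d <- divisors n) ('Phi_d \Po 'X^mu)
    = \prod_(d <- divisors n) A d :> {poly int}.
  rewrite -rmorph_prod prod_Cyclotomic // rmorphB rmorph1 /= comp_Xn_poly.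
  rewrite -exprM mulnC -prod_Cyclotomic //.
  apply: big_fibers; first exact: divisors_uniq.
  by move=> m; rewrite -!dvdn_divisors // dvdn_gamma.
have nD : n \in divisors n by rewrite divisors_id.
have uD := divisors_uniq n.
rewrite !(bigD1_seq n nD uD) /= in EA.
have E1 : \prod_(d <- divisors n | d != n) ('Phi_d \Po 'X^mu)
    = \prod_(d <- divisors n | d != n) A d :> {poly int}.
  rewrite big_seq_cond [RHS]big_seq_cond; apply: eq_bigr => d /andP[].
  rewrite -dvdn_divisors // => d_n d_neq.
  have d0 : (0 < d)%N by rewrite (dvdn_gt0 n0).
  have lt_dn : (d < n)%N by rewrite ltn_neqAle d_neq dvdn_leq.
  rewrite (IHk d (leq_trans lt_dn le_nk) d0) /A.
  rewrite -[LHS]big_filter -[RHS]big_filter; apply/perm_big/uniq_perm.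
  - by rewrite filter_uniq ?divisors_uniq.
  - by rewrite filter_uniq ?divisors_uniq.
  move=> m; rewrite !mem_filter -!dvdn_divisors ?muln_gt0 ?d0 ?n0 //.
  apply: andb_id2l => /eqP Em; rewrite -!dvdn_gamma // Em d_n.
  by rewrite dvdnn.
move: EA; rewrite E1; apply: mulIf.
by apply/monic_neq0/monic_prod => d _; apply: monic_prod_Cyclotomic.
Qed.

Lemma sum_totient_fiber mu n : (0 < mu)%N -> (0 < n)%N ->
  (\sum_(m <- divisors (n * mu) | gamma mu m == n) totient m)%N
    = (totient n * mu)%N.
Proof.
move=> mu0 n0; have := congr1 (fun p : {poly int} => (size p).-1)
  (comp_Xn_Cyclotomic mu0 n0).
rewrite size_comp_poly size_polyXn size_Cyclotomic /= => ->.
rewrite size_monic_prod_pred => [|m _]; last exact: Cyclotomic_monic.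
by apply: eq_bigr => m _; rewrite size_Cyclotomic.
Qed.

(** * Comaximal cyclotomic polynomials *)

Lemma Cyclotomic_dvd_Xn_sub_1 m n : (0 < n)%N -> (m %| n)%N ->
  divides ('Phi_m : {poly int}) ('X^n - 1).
Proof.
move=> n0 m_n; rewrite -prod_Cyclotomic //.
by apply: (divides_prod_seq (fun d => 'Phi_d)); rewrite -dvdn_divisors.
Qed.

Lemma Xn_sub_1_dvd (R : comNzRingType) m n : (m %| n)%N ->
  divides ('X^m - 1 : {poly R}) ('X^n - 1).
Proof.
move=> /dvdnP[k ->]; exists (\sum_(i < k) ('X^m) ^+ i).
by rewrite mulnC exprM subrX1 mulrC.
Qed.

(** With x = X^(m / p), the polynomial Phi_m divides
(X^m - 1) / (x - 1) = 1 + x + ... + x^(p - 1), and this sum is p modulo x - 1,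
hence modulo X^g - 1. *)
Lemma Cyclotomic_prime_mod p m g : prime p -> (0 < m)%N -> (g * p %| m)%N ->
  exists u v, p%:R = u * 'Phi_m + v * ('X^g - 1) :> {poly int}.
Proof.
move=> p_pr m0 gpm; have p0 := prime_gt0 p_pr.
have pm : (p %| m)%N := dvdn_trans (dvdn_mull g (dvdnn p)) gpm.
have [m1 /esym Em] := dvdnP pm.
have m10 : (0 < m1)%N by move: m0; rewrite -Em muln_gt0 => /andP[].
have gm1 : (g %| m1)%N by rewrite -(@dvdn_pmul2r p) // Em.
pose S : {poly int} := \sum_(i < p) ('X^m1) ^+ i.
have [u Su] : exists u, S = u * 'Phi_m.
  have ES : ('X^m1 - 1) * S = 'X^m - 1.
    by rewrite -[in RHS]Em exprM /S [RHS]subrX1.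
  pose A : {poly int} := \prod_(d <- divisors m | ~~ (d %| m1)%N) 'Phi_d.
  have EA : S = A.
    have Xm1 : 'X^m1 - 1 != 0 :> {poly int}.
      by rewrite monic_neq0 // -prod_Cyclotomic // monic_prod_Cyclotomic.
    apply: (mulfI Xm1); rewrite ES -prod_Cyclotomic // (bigID (dvdn^~ m1)) /=.
    congr (_ * _); rewrite -prod_Cyclotomic // -[LHS]big_filter.
    apply/perm_big/uniq_perm; rewrite ?filter_uniq ?divisors_uniq //.
    move=> d; rewrite mem_filter -!dvdn_divisors //.
    by apply: andb_idr => /dvdn_trans; apply; rewrite -Em dvdn_mulr.
  rewrite EA /A -big_filter (bigD1_seq m) ?filter_uniq ?divisors_uniq //=.
    by rewrite mulrC; eexists.
  rewrite mem_filter divisors_id // andbT; apply/negP => /(dvdn_leq m10).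
  by rewrite leqNgt -[X in (_ < X)%N]Em ltn_Pmulr ?prime_gt1.
have [v Sv] : exists v, S - p%:R = v * ('X^g - 1).
  have [w Ew] := Xn_sub_1_dvd int gm1.
  exists ((\sum_(i < p) \sum_(j < i) ('X^m1) ^+ j) * w).
  rewrite -mulrA -Ew mulr_suml /S -[p in p%:R]card_ord -sumr_const -sumrB.
  by apply: eq_bigr => i _; rewrite subrX1 mulrC.
by exists u, (- v); rewrite mulNr -Su -Sv opprB addrC subrK.
Qed.

(** Let g be the gcd of m and m'. The ideal generated by Phi_m and Phi_m'
contains X^g - 1, by a Bezout relation between the exponents, hence every prime
divisor of m / g and of m' / g ([Cyclotomic_prime_mod]). If two different primes
occur, the ideal contains 1. Otherwise m / g and m' / g, being coprime, are 1
and a power of a prime. *)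
Lemma comaximal_Cyclotomic m m' : (0 < m)%N -> (0 < m')%N ->
  (forall p k, prime p -> m <> (p ^ k * m')%N /\ m' <> (p ^ k * m)%N) ->
  comaximal ('Phi_m : {poly int}) 'Phi_m'.
Proof.
move=> m0 m'0 noedge; set g := gcdn m m'.
have g0 : (0 < g)%N by rewrite gcdn_gt0 m0.
pose I x := exists u v, x = u * 'Phi_m + v * 'Phi_m' :> {poly int}.
have I1 u : I (u * 'Phi_m) by exists u, 0; rewrite mul0r addr0.
have I2 u : I (u * 'Phi_m') by exists 0, u; rewrite mul0r add0r.
have ID x y : I x -> I y -> I (x + y).
  move=> [u [v ->]] [u' [v' ->]]; exists (u + u'), (v + v').
  by rewrite !mulrDl addrACA.
have IM a x : I x -> I (a * x).
  by move=> [u [v ->]]; exists (a * u), (a * v); rewrite mulrDr !mulrA.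
have IXg : I ('X^g - 1).
  have [a b Eab _] := egcdnP m' m0; rewrite -/g in Eab.
  have IX k : I ('X^(k * m) - 1) /\ I ('X^(k * m') - 1).
    have [q ->] := Xn_sub_1_dvd int (dvdn_mull k (dvdnn m)).
    have [q' ->] := Xn_sub_1_dvd int (dvdn_mull k (dvdnn m')).
    have [u ->] := Cyclotomic_dvd_Xn_sub_1 m0 (dvdnn m).
    have [u' ->] := Cyclotomic_dvd_Xn_sub_1 m'0 (dvdnn m').
    by rewrite !mulrA.
  have -> : 'X^g - 1
      = ('X^(a * m) - 1) + (- 'X^g) * ('X^(b * m') - 1) :> {poly int}.
    by rewrite Eab exprD; ring.
  by apply: ID; [case: (IX a) | apply: IM; case: (IX b)].
pose a := (m %/ g)%N; pose b := (m' %/ g)%N.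
have Em : m = (a * g)%N by rewrite divnK // dvdn_gcdl.
have Em' : m' = (b * g)%N by rewrite divnK // dvdn_gcdr.
have a0 : (0 < a)%N by move: m0; rewrite Em muln_gt0 => /andP[].
have b0 : (0 < b)%N by move: m'0; rewrite Em' muln_gt0 => /andP[].
have cop_ab : coprime a b.
  by rewrite /coprime -(eqn_pmul2r g0) muln_gcdl -Em -Em' mul1n.
have Ip p : prime p -> (p %| a * b)%N -> I p%:R.
  move=> p_pr; rewrite Euclid_dvdM // => /orP[] pab.
    have gpm : (g * p %| m)%N by rewrite Em mulnC dvdn_mul.
    have [u [v ->]] := Cyclotomic_prime_mod p_pr m0 gpm.
    by apply: ID => //; apply: IM.
  have gpm : (g * p %| m')%N by rewrite Em' mulnC dvdn_mul.
  have [u [v ->]] := Cyclotomic_prime_mod p_pr m'0 gpm.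
  by apply: ID => //; apply: IM.
have ab1 : (1 < a * b)%N.
  rewrite ltn_neqAle eq_sym muln_gt0 a0 b0 andbT muln_eq1.
  rewrite andbT; apply/negP => /andP[/eqP a1 /eqP b1].
  apply: (noedge 2%N 0%N isT).1.
  by rewrite expn0 mul1n Em Em' a1 b1.
have ab0 : (0 < a * b)%N := ltnW ab1.
set p := pdiv (a * b); have p_pr : prime p := pdiv_prime ab1.
have [/allP pab|] := boolP (all (pred1 p) (primes (a * b))).
  have pnat_ab : p.-nat (a * b)%N.
    apply/pnatP => // q q_pr q_ab; rewrite inE.
    by apply: pab; rewrite mem_primes q_pr ab0.
  move: pnat_ab; rewrite pnatM; move=> /andP[/p_natP[i Ea] /p_natP[j Eb]].
  case: i Ea => [|i] Ea.
    exfalso; apply: (noedge p j p_pr).2.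
    by rewrite Em' Em Ea Eb expn0 mul1n.
  case: j Eb => [|j] Eb.
    exfalso; apply: (noedge p i.+1 p_pr).1.
    by rewrite Em' Em Ea Eb expn0 mul1n.
  move: cop_ab; rewrite Ea Eb coprime_pexpl // coprime_pexpr //.
  by rewrite /coprime gcdnn => /eqP p1; rewrite p1 in p_pr.
move=> /allPn[q]; rewrite mem_primes => /and3P[q_pr _ q_ab] /= neq_qp.
have [u v Euv _] := egcdnP q (prime_gt0 p_pr).
have cop_pq : coprime p q by rewrite prime_coprime // dvdn_prime2 // eq_sym.
have E1 : 1 = u%:R * p%:R + (- v%:R) * q%:R :> {poly int}.
  by rewrite mulNr -!natrM Euv (eqP cop_pq) natrD addrC addKr.
have [U [V EUV]] : I 1.
  by rewrite E1; apply: ID; apply: IM; apply: Ip => //; apply: pdiv_dvd.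
by exists U, V.
Qed.

(** * Cyclotomic rings over the subring generated by a power *)

Lemma Cyclotomic_dvd_comp_Xn k m : (0 < k)%N -> (0 < m)%N ->
  divides ('Phi_m : {poly int}) ('Phi_(gamma k m) \Po 'X^k).
Proof.
move=> k0 m0; rewrite comp_Xn_Cyclotomic ?gamma_gt0 // -big_filter.
apply: (divides_prod_seq (fun d => 'Phi_d)).
rewrite mem_filter eqxx -dvdn_divisors ?muln_gt0 ?gamma_gt0 //.
by rewrite -dvdn_gamma // dvdnn.
Qed.

(** The fiber of gamma a over n is reduced to n * a when all primes of a divide
n, so that [sum_totient_fiber] has a single term. *)
Lemma totient_muln_pi n a : (0 < n)%N -> \pi(n).-nat a ->
  totient (n * a) = (totient n * a)%N.
Proof.
move=> n0 pia; have a0 : (0 < a)%N by case/andP: pia.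
rewrite -sum_totient_fiber // -big_filter.
rewrite (perm_big [:: (n * a)%N]) ?big_seq1 //=.
apply: uniq_perm => // [|m]; first by rewrite filter_uniq ?divisors_uniq.
rewrite mem_filter inE -dvdn_divisors ?muln_gt0 ?n0 //.
apply/andP/eqP => [[/eqP Em _]|->]; last first.
  by rewrite /gamma gcdnC gcdnMl mulnK.
have := coprime_gamma m a0; rewrite Em => cop.
have ga : (gcdn m a %| a)%N := dvdn_gcdr m a.
have ag_pi : \pi(n).-nat (a %/ gcdn m a)%N by apply: pnat_div.
have ag0 : (0 < a %/ gcdn m a)%N by case/andP: ag_pi.
move: cop; rewrite coprime_pi' // => /(pnat_1 ag_pi) ag1.
by rewrite -[m in LHS](gammaM a) Em -[in RHS](divnK ga) ag1 mul1n.
Qed.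

(** The substitution G(T, s) |-> G(t, t^mu), where s is the variable of the
coefficients and T the outer variable. *)
Definition pow_eval mu : {poly {poly int}} -> {poly int} :=
  horner_eval 'X \o map_poly (comp_poly 'X^mu).

HB.instance Definition _ mu := GRing.RMorphism.on (pow_eval mu).

Lemma pow_evalC mu c : pow_eval mu c%:P = c \Po 'X^mu.
Proof. by rewrite /pow_eval /= map_polyC /horner_eval hornerC. Qed.

Lemma pow_evalX mu : pow_eval mu 'X = 'X.
Proof. by rewrite /pow_eval /= map_polyX /horner_eval hornerX. Qed.

Lemma pow_evalZ mu c F : pow_eval mu (c *: F) = (c \Po 'X^mu) * pow_eval mu F.
Proof. by rewrite -mul_polyC rmorphM /= pow_evalC. Qed.

(** Let zeta be a root of Phi_m, let n = gamma mu m, and split gcd(m, mu) as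
a * e, where a collects the primes of n. Up to a power of zeta^mu, the element
zeta^a is a primitive e-th root of unity, hence a root of Phi_e after rescaling
by that power. This equation for zeta over Z[zeta^mu] is monic of degree
a * totient e, which is totient m / totient n. *)
Lemma cyclotomic_tower mu m : (0 < mu)%N -> (0 < m)%N ->
  exists G : {poly {poly int}},
    [/\ G \is monic, ((size G).-1 * totient (gamma mu m))%N = totient m
      & divides ('Phi_m : {poly int}) (pow_eval mu G)].
Proof.
move=> mu0 m0; set n := gamma mu m; set d := gcdn m mu.
have n0 : (0 < n)%N by apply: gamma_gt0.
have d0 : (0 < d)%N by rewrite gcdn_gt0 m0.
have Emd : m = (n * d)%N by rewrite gammaM.
pose a := (d`_\pi(n))%N; pose e := (d`_(\pi(n)^'))%N.
have Ed : d = (a * e)%N by rewrite partnC.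
have a0 : (0 < a)%N by apply: part_gt0.
have e0 : (0 < e)%N by apply: part_gt0.
have pia : \pi(n).-nat a by apply: part_pnat.
have cop_ne : coprime n e by apply: pnat_coprime (pnat_pi n0) (part_pnat _ _).
have cop_ae : coprime a e by apply: pnat_coprime pia (part_pnat _ _).
pose mu2 := (mu %/ d * e)%N.
have Emu : mu = (mu2 * a)%N.
  by rewrite /mu2 -mulnA [(e * a)%N]mulnC -Ed divnK // dvdn_gcdr.
have cop_nmu2 : coprime n mu2 by rewrite coprimeMr cop_ne coprime_gamma.
(* K = a + c * mu is chosen with gcd(m, K) = n * a, so that zeta^K has order e *)
have [c _] := Bezoutl mu2 n0; rewrite (eqP cop_nmu2) => n_c.
pose K := ((1 + c * mu2) * a)%N.
have EK : K = (a + c * mu)%N by rewrite /K mulnDl mul1n -mulnA -Emu.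
have K0 : (0 < K)%N by rewrite EK addn_gt0 a0.
have Em : m = (n * e * a)%N by rewrite Emd Ed -mulnA [(e * a)%N]mulnC.
have gcd_mK : gcdn m K = (n * a)%N.
  rewrite Em -muln_gcdl; congr (_ * _)%N; rewrite gcdnC Gauss_gcdl.
    by apply/gcdn_idPr.
  rewrite /mu2 mulnA /coprime gcdnC.
  by rewrite addnC gcdnMDl gcdn1.
have gammaK : gamma K m = e.
  rewrite /gamma gcd_mK Em -mulnA [(e * a)%N]mulnC mulnA mulKn //.
  by rewrite muln_gt0 n0.
have tot_m : totient m = (totient n * (a * totient e))%N.
  rewrite Em -mulnA [(e * a)%N]mulnC mulnA totient_coprime ?coprimeMl ?cop_ne //.
  by rewrite totient_muln_pi // mulnA.
(* mu * (c + c') is a multiple of m, so zeta^a = zeta^K * (zeta^mu)^c', and G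
   is s^(c' * f) * Phi_e(T^a / s^c') *)
pose f := totient e; pose c' := (c * m.-1)%N.
pose term j : {poly {poly int}} :=
  (('Phi_e)`_j *: 'X^(c' * (f - j))) *: 'X^(a * j).
pose G := \sum_(j < f.+1) term j.
have EG : G = 'X^(a * f) + \sum_(j < f) term j.
  rewrite /G big_ord_recr addrC /= /term subnn muln0 expr0; congr (_ + _).
  have /monicP := Cyclotomic_monic e; rewrite lead_coefE size_Cyclotomic /= => ->.
  by rewrite !scale1r.
have szG : (size (\sum_(j < f) term j)%R
    < size ('X^(a * f) : {poly {poly int}}))%N.
  rewrite size_polyXn ltnS; apply: (leq_trans (size_sum _ _ _)).
  apply/bigmax_leqP => j _; apply: (leq_trans (size_scale_leq _ _)).
  by rewrite size_polyXn ltn_mul2l a0 ltn_ord.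
exists G; split.
- by rewrite EG monicE lead_coefDl // lead_coefXn.
- by rewrite EG size_polyDl // size_polyXn tot_m mulnC.
have -> : pow_eval mu G = 'X^(mu * c' * f) * ('Phi_e \Po 'X^K)
    + \sum_(j < f.+1) (('Phi_e)`_j)%:P * 'X^(mu * (c' * (f - j)) + a * j)
        * - ('X^(m * (c * mu * j)) - 1).
  rewrite comp_polyE size_Cyclotomic -/f mulr_sumr -big_split rmorph_sum /=.
  apply: eq_bigr => j _; rewrite /term pow_evalZ comp_polyZ comp_Xn_poly.
  rewrite rmorphXn /= pow_evalX -!mul_polyC -!exprM.
  have key : 'X^(mu * c' * f) * 'X^(K * j)
      = 'X^(mu * (c' * (f - j)) + a * j) * 'X^(m * (c * mu * j)) :> {poly int}.
    rewrite -!exprD; congr 'X^_; have jf : (j <= f)%N by rewrite -ltnS.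
    rewrite -{1}(subnK jf) EK /c' -[in RHS](prednK m0) /=.
    by set x := (f - j)%N; set y := m.-1; ring.
  rewrite mulrCA key !exprD; ring.
apply: dividesD.
  by apply: divides_mull; rewrite -gammaK; exact: Cyclotomic_dvd_comp_Xn.
apply: divides_sum => j _; apply/divides_mull/dividesN.
apply: divides_trans (Cyclotomic_dvd_Xn_sub_1 m0 (dvdnn m)) _.
exact/Xn_sub_1_dvd/dvdn_mulr.
Qed.

(** * Generation by powers of t over Z[t^mu] *)

(** The powers 1, t, ..., t^(r - 1) generate Z[t]/P as a module over Z[t^mu]. *)
Definition powers_span mu (P : {poly int}) (r : nat) :=
  forall x : {poly int}, exists2 F : {poly {poly int}},
    (size F <= r)%N & divides P (x - pow_eval mu F).

Lemma powers_span_leq mu P r r' : (r <= r')%N ->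
  powers_span mu P r -> powers_span mu P r'.
Proof.
move=> rr' Pr x; have [F sF PF] := Pr x.
by exists F => //; apply: leq_trans rr'.
Qed.

Lemma powers_span_one mu r : powers_span mu 1 r.
Proof.
move=> x; exists 0; rewrite ?size_poly0 //.
by exists (x - pow_eval mu 0); rewrite mulr1.
Qed.

Lemma pow_eval_map_polyC mu (x : {poly int}) :
  pow_eval mu (map_poly polyC x) = x.
Proof.
rewrite /pow_eval /= /horner_eval -map_poly_comp (@eq_map_poly _ _ _ polyC).
  by rewrite -[RHS]comp_polyXr.
by move=> c /=; rewrite comp_polyC.
Qed.

(** Division with remainder by G in Z[s][T]. *)
Lemma powers_span_monic mu P G : G \is monic -> divides P (pow_eval mu G) ->
  powers_span mu P (size G).-1.
Proof.
move=> G_monic PG x; pose F := map_poly polyC x.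
exists (Pdiv.Ring.rmodp F G).
  by rewrite -ltnS -polySpred ?monic_neq0 // Pdiv.Ring.ltn_rmodpN0 ?monic_neq0.
have -> : x - pow_eval mu (Pdiv.Ring.rmodp F G)
    = pow_eval mu (Pdiv.Ring.rdivp F G) * pow_eval mu G.
  rewrite -{1}(pow_eval_map_polyC mu x) -/F.
  by rewrite {1}(Pdiv.RingMonic.rdivp_eq G_monic F) rmorphD rmorphM /= addrK.
exact: divides_mull.
Qed.

(** What is left after a division modulo P is a multiple of P. As u is a unit
modulo P', it can be written as P * u times a combination of powers of t modulo
P * P', and P * u = c(t^mu) is a scalar. *)
Lemma powers_span_mul mu (P P' c u : {poly int}) r r' :
  c \Po 'X^mu = P * u -> comaximal u P' -> (r' <= r)%N ->
  powers_span mu P r -> powers_span mu P' r' -> powers_span mu (P * P') r.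
Proof.
move=> cPu [v [w uv]] le_r'r Pr P'r' x.
have [F sF [q Eq]] := Pr x; have [F' sF' [q' Eq']] := P'r' (q * v).
exists (F + c *: F').
  rewrite (leq_trans (size_polyD _ _)) // geq_max sF.
  by rewrite (leq_trans (size_scale_leq _ _)) // (leq_trans sF').
exists (q * w + u * q'); rewrite rmorphD /= pow_evalZ cPu opprD addrA Eq.
have -> : pow_eval mu F' = q * v - q' * P' by rewrite -Eq' opprB addrC subrK.
have -> : q * P = q * P * (v * u + w * P') by rewrite uv mulr1.
ring.
Qed.

(** The factors are split off in the order of decreasing r, so that at each step
u i is a unit modulo the product of the factors that remain. *)
Lemma powers_span_prod mu (I : eqType) (s : seq I) (P c u : I -> {poly int})
    (r : I -> nat) (R : nat) :
  uniq s ->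
  {in s, forall i, c i \Po 'X^mu = P i * u i} ->
  {in s, forall i, powers_span mu (P i) (r i)} ->
  {in s &, forall i j, i != j -> (r j <= r i)%N -> comaximal (u i) (P j)} ->
  {in s, forall i, (r i <= R)%N} ->
  powers_span mu (\prod_(i <- s) P i) R.
Proof.
pose ger i j := (r j <= r i)%N.
have ger_trans : transitive ger by move=> j i k ij jk; apply: leq_trans ij.
have ger_total : total ger by move=> i j; apply: leq_total.
have perm_s : perm_eq s (sort ger s) by rewrite perm_sym perm_sort.
have mem_s := mem_sort ger s.
rewrite -(sort_uniq ger) (perm_big _ perm_s) => s_uniq cP Pr uP rR {perm_s}.
have {}cP i : i \in sort ger s -> c i \Po 'X^mu = P i * u i.
  by rewrite mem_s; apply: cP.
have {}Pr i : i \in sort ger s -> powers_span mu (P i) (r i).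
  by rewrite mem_s; apply: Pr.
have {}rR i : i \in sort ger s -> (r i <= R)%N by rewrite mem_s; apply: rR.
have {}uP i j : i \in sort ger s -> j \in sort ger s ->
    i != j -> (r j <= r i)%N -> comaximal (u i) (P j).
  by rewrite !mem_s; apply: uP.
have := sort_sorted ger_total s.
move: (sort ger s) s_uniq cP Pr uP rR {mem_s} => {}s.
elim: s R => [|i s IHs] R /=.
  by move=> *; rewrite big_nil; apply: powers_span_one.
move=> /andP[i_s s_uniq] cP Pr uP rR i_path; rewrite big_cons.
have le_ri j : j \in s -> (r j <= r i)%N.
  by move=> js; have /allP := order_path_min ger_trans i_path; apply.
have ii : i \in i :: s := mem_head i s.
have sS j : j \in s -> j \in i :: s by rewrite inE orbC => ->.
apply: (powers_span_leq (rR i ii)).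
apply: (@powers_span_mul mu _ _ (c i) (u i) (r i) (r i)) => //.
- exact: cP.
- apply: comaximal_prodr => j js _; apply: uP => //; [exact: sS| |exact: le_ri].
  by apply: contraNneq i_s => ->.
- exact: Pr.
apply: IHs => //; [|by move=> j /sS; apply: Pr| |exact: path_sorted i_path].
  by move=> j /sS; apply: cP.
by move=> j k /sS js /sS ks; apply: uP.
Qed.

(** Modulo the product of the P i with r i <= k, the power t^k is a combination
of lower ones by [powers_span_prod]; B k is the difference. The factors P i with
r i > k are supplied by their multiples c i(t^mu). *)
Lemma powers_span_annihilated_basis mu (I : eqType) (s : seq I)
    (c P u : I -> {poly int}) (r : I -> nat) :
  uniq s ->
  {in s, forall i, c i \Po 'X^mu = P i * u i} ->
  {in s, forall i, powers_span mu (P i) (r i)} ->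
  {in s &, forall i j, i != j -> (r j <= r i)%N -> comaximal (u i) (P j)} ->
  exists B : nat -> {poly {poly int}}, forall k,
    [/\ B k \is monic, size (B k) = k.+1
      & divides (\prod_(i <- s) P i)
          (((\prod_(i <- s | (k < r i)%N) c i) \Po 'X^mu) * pow_eval mu (B k))].
Proof.
move=> s_uniq cP Pr uP.
suff /choice : forall k, exists B : {poly {poly int}},
    [/\ B \is monic, size B = k.+1
      & divides (\prod_(i <- s) P i)
          (((\prod_(i <- s | (k < r i)%N) c i) \Po 'X^mu) * pow_eval mu B)].
  by case=> B BP; exists B.
move=> k; pose t := [seq i <- s | (r i <= k)%N].
have st : {subset t <= s} by move=> i; rewrite mem_filter => /andP[].
have [] := @powers_span_prod mu I t P c u r k _ _ _ _ _ 'X^k.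
- exact: filter_uniq.
- by move=> i /st; apply: cP.
- by move=> i /st; apply: Pr.
- by move=> i j /st si /st sj; apply: uP.
- by move=> i; rewrite mem_filter => /andP[].
move=> F sF PF.
have sF' : (size (- F) < size ('X^k : {poly {poly int}}))%N.
  by rewrite size_polyN size_polyXn.
exists ('X^k - F); split; first by rewrite monicE lead_coefDl // lead_coefXn.
  by rewrite size_polyDl // size_polyXn.
rewrite (bigID (fun i => (k < r i)%N)) /=; apply: divides_mul.
  rewrite rmorph_prod /= big_seq_cond [X in divides _ X]big_seq_cond.
  elim/big_rec2: _ => [|i x y /andP[si _] xy]; first by exists 1; rewrite mulr1.
  by apply: divides_mul => //; rewrite cP //; exists (u i); rewrite mulrC.
move: PF; rewrite rmorphB rmorphXn /= pow_evalX /t big_filter.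
by under eq_bigl do rewrite leqNgt.
Qed.

Lemma monic_family_gen (A : nzRingType) (B : nat -> {poly A}) (r : nat)
    (F : {poly A}) :
  (forall i, (i < r)%N -> B i \is monic /\ size (B i) = i.+1) ->
  (size F <= r)%N ->
  exists f : 'I_r -> A, F = \sum_(i < r) f i *: B i.
Proof.
elim: r F => [|r IHr] F BP sF.
  exists (fun=> 0); rewrite big_ord0; apply/eqP.
  by rewrite -size_poly_eq0 -leqn0.
have [Br sBr] := BP r (ltnSn r).
have [|f Ef] := IHr (F - F`_r *: B r) (fun i ir => BP i (ltnW ir)).
  apply/leq_sizeP => j; rewrite leq_eqVlt => /predU1P[<-|rj].
    rewrite coefB coefZ; move/monicP: Br; rewrite lead_coefE sBr /= => ->.
    by rewrite mulr1 subrr.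
  rewrite coefB coefZ (nth_default 0 (leq_trans sF rj)).
  by rewrite (@nth_default _ 0 (B r)) ?mulr0 ?subrr ?sBr.
exists (fun i => if unlift ord_max i is Some j then f j else F`_r).
rewrite big_ord_recr /= unlift_none -[LHS](subrK (F`_r *: B r)) Ef.
congr (_ + _); apply: eq_bigr => i _.
have -> : widen_ord (leqnSn r) i = lift ord_max i; last by rewrite liftK.
by apply: val_inj; rewrite /= /bump leqNgt ltn_ord.
Qed.

(** * Weights of the fibers of gamma *)

Lemma mem_fiber mu n m : (0 < mu)%N -> (0 < n)%N -> gamma mu m = n ->
  m \in divisors (n * mu).
Proof.
move=> mu0 n0 Em; rewrite -dvdn_divisors ?muln_gt0 ?n0 //.
by rewrite -dvdn_gamma // Em.
Qed.

Lemma partn_gamma mu m (pi : nat_pred) : (0 < mu)%N -> (0 < m)%N ->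
  ((gamma mu m)`_pi = gamma mu`_pi m`_pi)%N.
Proof.
move=> mu0 m0; have g0 : (0 < (gcdn m mu)`_pi)%N by apply: part_gt0.
apply/eqP; rewrite -(eqn_pmul2r g0) -partnM ?gamma_gt0 ?gcdn_gt0 ?m0 //.
by rewrite gammaM partn_gcd // gammaM.
Qed.

Lemma gamma_partn mu m (pi : nat_pred) : (0 < m)%N ->
  (gamma mu`_pi m = gamma mu`_pi m`_pi * m`_pi^')%N.
Proof.
move=> m0; rewrite {1}/gamma -{2}(partnC pi m0) gcdnC Gauss_gcdl ?coprime_partC //.
by rewrite gcdnC -{1}(partnC pi m0) divn_mulAC // dvdn_gcdl.
Qed.

Lemma partn_mul_inj (pi : nat_pred) x y x' y' :
  pi.-nat x -> pi.-nat x' -> pi^'.-nat y -> pi^'.-nat y' ->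
  (x * y = x' * y')%N -> x = x' /\ y = y'.
Proof.
have aux u v : pi.-nat u -> pi^'.-nat v ->
    ((u * v)`_pi = u)%N /\ ((u * v)`_pi^' = v)%N.
  move=> piu piv; have u0 : (0 < u)%N by case/andP: piu.
  have v0 : (0 < v)%N by case/andP: piv.
  rewrite !partnM // (part_pnat_id piu) (part_pnat_id piv).
  rewrite part_p'nat // part_p'nat ?muln1 ?mul1n //.
  by rewrite pnatNK.
move=> px px' py py' E; have [Ex Ey] := aux _ _ px py.
have [Ex' Ey'] := aux _ _ px' py'.
by split; [rewrite -Ex E Ex' | rewrite -Ey E Ey'].
Qed.

(** The elements of the fiber over n with pi^'-part a are exactly the fiber of
gamma mu`_pi over n`_pi * a, to which [sum_totient_fiber] applies. The condition
on a expresses that a is the pi^'-part of some element over n. *)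
Lemma sum_totient_class mu (pi : nat_pred) n a : (0 < mu)%N -> (0 < n)%N ->
  pi^'.-nat a -> (gamma mu`_pi^' a = n`_pi^')%N ->
  (\sum_(m <- divisors (n * mu) | (gamma mu m == n) && (m`_pi^' == a)%N)
      totient m
    = totient n`_pi * (totient a * mu`_pi))%N.
Proof.
move=> mu0 n0 pia gamma_a; have a0 : (0 < a)%N by case/andP: pia.
have mup : (0 < mu`_pi)%N by apply: part_gt0.
have na0 : (0 < n`_pi * a)%N by rewrite muln_gt0 part_gt0.
rewrite mulnA -totient_coprime; last exact: pnat_coprime (part_pnat _ _) pia.
rewrite -sum_totient_fiber // -[LHS]big_filter -[RHS]big_filter.
apply/perm_big/uniq_perm; rewrite ?filter_uniq ?divisors_uniq // => m.
rewrite !mem_filter.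
rewrite [LHS]andb_idr; last by case/andP=> /eqP Em _; apply: mem_fiber.
rewrite [RHS]andb_idr; last by move=> /eqP Em; apply: mem_fiber.
have [->|m_gt0] := posnP m.
  by rewrite /gamma !div0n (ltn_eqF n0) (ltn_eqF na0).
have pn k l : (0 < k)%N -> pi.-nat (gamma l k`_pi).
  move=> k0; apply: pnat_dvd (part_pnat pi k).
  by rewrite /gamma dvdn_div // dvdn_gcdl.
rewrite gamma_partn //; apply/andP/eqP => [[/eqP Em /eqP Ea]|E].
  by rewrite Ea -partn_gamma // Em.
have [E1 E2] : gamma mu`_pi m`_pi = (n`_pi)%N /\ (m`_pi^' = a)%N.
  by apply: (@partn_mul_inj pi); rewrite ?part_pnat ?pn.
split; last exact/eqP.
rewrite -(partnC pi (gamma_gt0 mu m_gt0)) -(partnC pi n0) !partn_gamma //.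
by rewrite E1 E2 gamma_a.
Qed.

(** The degree of Q(zeta) over Q(zeta^mu), for zeta of order m. *)
Definition rho mu m := (totient m %/ totient (gamma mu m))%N.

Lemma rhoM mu m : (0 < mu)%N -> (0 < m)%N ->
  (rho mu m * totient (gamma mu m))%N = totient m.
Proof.
move=> mu0 m0; have [G [_ EG _]] := cyclotomic_tower mu0 m0.
by rewrite /rho -EG mulnK // totient_gt0 gamma_gt0.
Qed.

Lemma powers_span_prod_Cyclotomic mu (s : seq nat) (Q : pred nat) :
  (0 < mu)%N ->
  {in s, forall m, (0 < m)%N} ->
  powers_span mu (\prod_(m <- s | Q m) 'Phi_m) (\sum_(m <- s | Q m) rho mu m).
Proof.
move=> mu0 s0.
suff [G [G_monic <- PG]] : exists G : {poly {poly int}},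
    [/\ G \is monic, (size G).-1 = (\sum_(m <- s | Q m) rho mu m)%N
      & divides (\prod_(m <- s | Q m) 'Phi_m) (pow_eval mu G)].
  exact: powers_span_monic.
elim: s s0 => [|m s IHs] s0.
  exists 1; rewrite !big_nil monic1 size_poly1; split=> //.
  by rewrite rmorph1; exists 1; rewrite mulr1.
have [|G [G_monic sG PG]] := IHs.
  by move=> k ks; apply: s0; rewrite inE ks orbT.
rewrite !big_cons; case: ifP => _; last by exists G.
have m0 : (0 < m)%N by apply: s0; rewrite mem_head.
have [K [K_monic sK PK]] := cyclotomic_tower mu0 m0.
exists (K * G); split; first by rewrite monicMl.
  rewrite size_monicM ?monic_neq0 // -sG /rho -sK mulnK; last first.
    by rewrite totient_gt0 gamma_gt0.
  rewrite (polySpred (monic_neq0 K_monic)) (polySpred (monic_neq0 G_monic)).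
  by rewrite addnS.
by rewrite rmorphM /=; apply: divides_mul.
Qed.

Section Fibers.
Variables (M : {fset nat}) (mu : nat).
Hypothesis M_pos : forall m : nat, m \in M -> (0 < m)%N.
Hypothesis mu_pos : (0 < mu)%N.

(** The rank of Z[t]/fiber_poly n over Z[t^mu]/Phi_n(t^mu). *)
Definition fiber_rank n := (\sum_(m <- M | gamma mu m == n) rho mu m)%N.
Definition fiber_poly n : {poly int} := \prod_(m <- M | gamma mu m == n) 'Phi_m.
Definition fiber_cofactor n : {poly int} :=
  \prod_(m <- divisors (n * mu) | (gamma mu m == n) && (m \notin M)) 'Phi_m.

Lemma big_fiber_mem (R : Type) (idx : R) (op : Monoid.com_law idx) n
    (Q : pred nat) (F : nat -> R) : (0 < n)%N ->
  \big[op/idx]_(m <- divisors (n * mu) |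
                   (gamma mu m == n) && Q m && (m \in M)) F m
    = \big[op/idx]_(m <- M | (gamma mu m == n) && Q m) F m.
Proof.
move=> n0; rewrite -[LHS]big_filter -[RHS]big_filter.
apply/perm_big/uniq_perm; rewrite ?filter_uniq ?divisors_uniq ?fset_uniq // => m.
rewrite !mem_filter; have [Em|] := eqVneq (gamma mu m) n => //=.
by rewrite (mem_fiber mu_pos n0 Em) andbT.
Qed.

Lemma fiber_rankM n : (fiber_rank n * totient n
  = \sum_(m <- M | gamma mu m == n) totient m)%N.
Proof.
rewrite /fiber_rank big_distrl /= big_seq_cond [RHS]big_seq_cond.
by apply: eq_bigr => m /andP[/M_pos m0 /eqP <-]; rewrite rhoM.
Qed.

Lemma fiber_polyM n : (0 < n)%N ->
  'Phi_n \Po 'X^mu = fiber_poly n * fiber_cofactor n.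
Proof.
move=> n0; rewrite comp_Xn_Cyclotomic // (bigID (mem M)) /=; congr (_ * _).
have := big_fiber_mem *%R xpredT (fun m => 'Phi_m : {poly int}) n0.
rewrite /fiber_poly.
under eq_bigl do rewrite andbT.
by under [in RHS]eq_bigl do rewrite andbT.
Qed.

Lemma totient_class_in_fiber (pi : nat_pred) n a : (0 < n)%N ->
  pi^'.-nat a -> (gamma mu`_pi^' a = n`_pi^')%N ->
  let T :=
    (\sum_(m <- M | (gamma mu m == n) && (m`_pi^' == a)%N) totient m)%N in
  let W := (totient n`_pi * (totient a * mu`_pi))%N in
  [/\ (T <= W)%N,
      (forall m, (0 < m)%N -> m \notin M -> gamma mu m = n ->
         (m`_pi^' = a)%N -> (T < W)%N)
    & (forall m, gamma mu m = n -> (m`_pi^' = a)%N -> m \in M) -> T = W].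
Proof.
move=> n0 pia gamma_a T W.
have EW := sum_totient_class mu_pos n0 pia gamma_a; rewrite -/W in EW.
rewrite (bigID (mem M)) /= big_fiber_mem // -/T in EW.
rewrite -EW; split=> [|m m_gt0 mM Em Ea|full]; first exact: leq_addr.
  rewrite -[X in (X < _)%N]addn0 ltn_add2l -big_filter (bigD1_seq m) /=.
  - by rewrite addn_gt0 totient_gt0 m_gt0.
  - by rewrite mem_filter Em Ea !eqxx mM /= mem_fiber.
  - by rewrite filter_uniq ?divisors_uniq.
rewrite [X in (_ + X)%N]big_pred0 ?addn0 // => m.
by apply/negP => /andP[/andP[/eqP Em /eqP Ea]]; rewrite full.
Qed.

(** Divide the fibers over n and n' into classes of elements with the same
pi^'-part. By [sum_totient_class], the sum of the totients over a full class,
divided by totient n or totient n', is the same over n and over n'. By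
hypothesis, a class that meets M over n is full over n'; this gives the weak
inequality. It is strict because of the common class of m0 and m1: there m0 is
missing from M over n, while m1 is present over n'. *)
Lemma fiber_rank_lt (pi : nat_pred) n n' m0 m1 :
  (forall x y, x \in M -> gamma mu x = n -> gamma mu y = n' ->
     (x`_pi^' = y`_pi^')%N -> y \in M) ->
  m1 \in M -> gamma mu m1 = n' ->
  (0 < m0)%N -> m0 \notin M -> gamma mu m0 = n -> (m0`_pi^' = m1`_pi^')%N ->
  (fiber_rank n < fiber_rank n')%N.
Proof.
move=> full m1M Em1 m0_gt0 m0M Em0 E01; have m1_gt0 := M_pos m1M.
have n0 : (0 < n)%N by rewrite -Em0 gamma_gt0.
have n'0 : (0 < n')%N by rewrite -Em1 gamma_gt0.
have Epi' : (n`_pi^' = n'`_pi^')%N by rewrite -Em0 -Em1 !partn_gamma // E01.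
pose T k a :=
  (\sum_(m <- M | (gamma mu m == k) && (m`_pi^' == a)%N) totient m)%N.
pose s := undup [seq (m`_pi^')%N | m <- M].
have sumT k : (fiber_rank k * totient k = \sum_(a <- s) T k a)%N.
  rewrite fiber_rankM -big_filter.
  rewrite (big_fibers _ _ (f := fun m => m`_pi^')%N (undup_uniq _ : uniq s)).
    by apply: eq_bigr => a _; rewrite big_filter_cond.
  by move=> m; rewrite mem_filter mem_undup => /andP[_ mM]; apply: map_f.
pose W a := (totient a * mu`_pi)%N.
have class x : x \in M -> gamma mu x = n ->
    let a := (x`_pi^')%N in
    [/\ (T n a <= totient n`_pi * W a)%N,
        a = (m0`_pi^')%N -> (T n a < totient n`_pi * W a)%N
      & T n' a = (totient n'`_pi * W a)%N].
  move=> xM Ex a; have gamma_a : (gamma mu`_pi^' a = n`_pi^')%N.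
    by rewrite -partn_gamma ?Ex // M_pos.
  have [le_T lt_T _] := totient_class_in_fiber n0 (part_pnat _ x) gamma_a.
  split=> // [Ea|]; first exact: (lt_T m0).
  rewrite Epi' in gamma_a.
  have [_ _ eqT] := totient_class_in_fiber n'0 (part_pnat _ x) gamma_a.
  by apply: eqT => y Ey Eya; apply: (full x).
have T0 a : ~~ has (fun m => (gamma mu m == n) && (m`_pi^' == a)%N) M ->
    T n a = 0%N.
  move=> /hasPn noM; rewrite /T big_seq_cond big_pred0 // => m; apply/negP.
  by case/andP=> /noM /negP.
have le_T a : (T n a * totient n'`_pi <= T n' a * totient n`_pi)%N.
  have [/hasP[x xM /andP[/eqP Ex /eqP <-]]|/T0->//] :=
    boolP (has (fun m => (gamma mu m == n) && (m`_pi^' == a)%N) M).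
  have [le_x _ ->] := class x xM Ex.
  by rewrite mulnC -mulnA leq_mul2l [(W _ * _)%N]mulnC le_x orbT.
pose a1 := (m1`_pi^')%N.
have lt_T : (T n a1 * totient n'`_pi < T n' a1 * totient n`_pi)%N.
  have [/hasP[x xM /andP[/eqP Ex /eqP Exa]]|/T0->] :=
    boolP (has (fun m => (gamma mu m == n) && (m`_pi^' == a1)%N) M).
    have [_ lt_x Tx] := class x xM Ex; rewrite Exa in lt_x Tx.
    rewrite Tx mulnC -mulnA ltn_mul2l [(W _ * _)%N]mulnC lt_x // andbT.
    by rewrite totient_gt0 part_gt0.
  rewrite mul0n muln_gt0 totient_gt0 part_gt0 andbT /T -big_filter.
  rewrite (bigD1_seq m1) ?filter_uniq ?fset_uniq //=; last first.
    by rewrite mem_filter Em1 m1M !eqxx.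
  by rewrite addn_gt0 totient_gt0 m1_gt0.
rewrite -(ltn_pmul2r (m := totient n * totient n'`_pi)%N); last first.
  by rewrite muln_gt0 !totient_gt0 n0 part_gt0.
have -> : (fiber_rank n' * (totient n * totient n'`_pi)
    = fiber_rank n' * totient n' * totient n`_pi)%N.
  have tot k : (0 < k)%N -> totient k = (totient k`_pi * totient k`_pi^')%N.
    by move=> k0; rewrite -totient_coprime ?coprime_partC // partnC.
  by rewrite (tot n) // (tot n') // Epi'; ring.
rewrite mulnA !sumT !big_distrl /=.
have a1s : a1 \in s by rewrite mem_undup; apply: map_f.
rewrite !(bigD1_seq a1 a1s (undup_uniq _)) /=.
by rewrite -addSn leq_add // leq_sum.
Qed.

End Fibers.

(** * Edges between fibers *)

Lemma partn_pmul p k y : prime p -> (0 < y)%N ->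
  ((p ^ k * y)`_p^' = y`_p^')%N.
Proof.
move=> p_pr y0; have pk0 : (0 < p ^ k)%N by rewrite expn_gt0 prime_gt0.
rewrite partnM // part_p'nat ?mul1n //.
by rewrite pnatNK pnatX pnat_id.
Qed.

Lemma gamma_pmul mu p k y : prime p -> (0 < mu)%N -> (0 < y)%N ->
  exists j, gamma mu (p ^ k * y) = (p ^ j * gamma mu y)%N.
Proof.
move=> p_pr mu0 y0; set x := (p ^ k * y)%N.
have x0 : (0 < x)%N by rewrite muln_gt0 expn_gt0 prime_gt0.
have /dvdnP[q Eq] : (gamma mu y %| gamma mu x)%N.
  rewrite dvdn_gamma //; apply: (@dvdn_trans x); first exact: dvdn_mull.
  by rewrite -dvdn_gamma.
have q0 : (0 < q)%N by have := gamma_gt0 mu x0; rewrite Eq muln_gt0 => /andP[].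
have /p_natP[j Ej] : p.-nat q.
  rewrite -[p.-nat q]pnatNK -partn_eq1 //.
  have g0 : (0 < (gamma mu y)`_p^')%N by apply: part_gt0.
  rewrite -(eqn_pmul2r g0) mul1n -partnM ?gamma_gt0 // -Eq.
  by rewrite !partn_gamma // partn_pmul.
by exists j; rewrite Eq Ej.
Qed.

(** The numbers x and y differ by a power of p in one direction or the other,
and gamma mu respects the direction. *)
Lemma p_edge_fibers mu p n n' x y k : prime p -> (0 < mu)%N ->
  (0 < n)%N -> (0 < k)%N -> n = (p ^ k * n')%N ->
  (0 < x)%N -> (0 < y)%N ->
  gamma mu x = n -> gamma mu y = n' -> (x`_p^' = y`_p^')%N -> p_edges p (x, y).
Proof.
move=> p_pr mu0 n0 k0 En x0 y0 Ex Ey xy.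
have n'0 : (0 < n')%N by rewrite -Ey gamma_gt0.
have pE z : (0 < z)%N -> exists i, z = (p ^ i * z`_p^')%N.
  move=> z0; have /p_natP[i Ei] := part_pnat p z.
  by exists i; rewrite -Ei partnC.
have [i Exi] := pE x x0; have [j Eyj] := pE y y0.
split=> //=; have [ij|ji] := leqP i j; last first.
  exists (i - j)%N; first by rewrite subn_gt0.
  by rewrite {1}Exi {1}Eyj mulnA -expnD subnK ?xy // ltnW.
have Eyx : y = (p ^ (j - i) * x)%N.
  by rewrite {1}Eyj {1}Exi mulnA -expnD subnK // xy.
have [l El] := gamma_pmul (j - i) p_pr mu0 x0.
have : (n < n)%N; last by rewrite ltnn.
rewrite -Eyx Ey Ex in El.
have lt_n : (n' < n)%N.
  rewrite En -[X in (X < _)%N]mul1n ltn_pmul2r //.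
  by rewrite -[1%N](expn0 p) ltn_exp2l ?prime_gt1.
have : (n <= n')%N by rewrite El leq_pmull // expn_gt0 prime_gt0.
by rewrite leqNgt lt_n.
Qed.

(** Otherwise a p-edge joins some m0 outside M over n to some m1 in M over n',
and (n, n') or (n', n) is a p-edge as well. One alternative of sufficiency puts m0
into M; the other is the hypothesis of [fiber_rank_lt], which contradicts the
inequality between the ranks. *)
Lemma comaximal_fibers (M : {fset nat}) mu n n' :
  (forall m : nat, m \in M -> (0 < m)%N) -> (0 < mu)%N ->
  sdiOb_sufficient M mu ->
  (exists2 m, m \in M & gamma mu m = n) ->
  (exists2 m, m \in M & gamma mu m = n') ->
  n != n' -> (fiber_rank M mu n' <= fiber_rank M mu n)%N ->
  comaximal (fiber_cofactor M mu n) (fiber_poly M mu n').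
Proof.
move=> M_pos mu0 suff_M [m2 m2M Em2] [m3 m3M Em3] neq le_r.
have n0 : (0 < n)%N by rewrite -Em2 gamma_gt0 ?M_pos.
have n'0 : (0 < n')%N by rewrite -Em3 gamma_gt0 ?M_pos.
apply: comaximal_prodr => m1 m1M /eqP Em1; apply: comaximalC.
have m1_gt0 := M_pos _ m1M.
apply: comaximal_prodr => m0; rewrite -dvdn_divisors ?muln_gt0 ?n0 // => m0_n.
move=> /andP[/eqP Em0 m0M].
have m0_gt0 : (0 < m0)%N by apply: dvdn_gt0 m0_n; rewrite muln_gt0 n0.
have nN : (gamma mu @` [set` M])%classic n by exists m2.
have n'N : (gamma mu @` [set` M])%classic n' by exists m3.
have ltP p : (m0`_p^' = m1`_p^')%N -> ~ (forall x y, x \in M ->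
    gamma mu x = n -> gamma mu y = n' -> (x`_p^' = y`_p^')%N -> y \in M).
  move=> m01 full; move: le_r; rewrite leqNgt => /negP; apply.
  exact: (fiber_rank_lt M_pos mu0 full m1M Em1 m0_gt0 m0M Em0 m01).
have pos_k p j x y : x = (p ^ j * y)%N -> x != y -> (0 < j)%N.
  by case: j => // ->; rewrite mul1n eqxx.
apply: comaximal_Cyclotomic => // p k p_pr; split=> E.
  (* the case where m1 is the larger end of the edge; in the other one, below,
     the two alternatives are exchanged *)
  have m01 : (m0`_p^' = m1`_p^')%N by rewrite E partn_pmul.
  have [j] := gamma_pmul k p_pr mu0 m0_gt0; rewrite -E Em0 Em1 => En'.
  have j0 : (0 < j)%N by apply: pos_k En' _; rewrite eq_sym.
  have edge x y := @p_edge_fibers mu p n' n x y j p_pr mu0 n'0 j0 En'.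
  have nedge : p_edges_on p (gamma mu @` [set` M]) (n', n).
    by split=> //; split=> //; exists j.
  case: (suff_M p p_pr n' n nedge) => full.
    have [] : p_edges_on p [set` M] (m1, m0).
      by apply: full; split=> //; apply: edge.
    by move=> _ [_ /= m0M']; rewrite m0M' in m0M.
  apply: (ltP p m01) => x y xM Ex Ey xy.
  have y0 : (0 < y)%N.
    by case: y Ey {xy} => // Ey; rewrite -Ey /gamma div0n in n'0.
  have [] : p_edges_on p [set` M] (y, x).
    by apply: full; split=> //; apply: edge => //; apply: M_pos.
  by move=> _ [].
have m01 : (m0`_p^' = m1`_p^')%N by rewrite E partn_pmul.
have [j] := gamma_pmul k p_pr mu0 m1_gt0; rewrite -E Em0 Em1 => En.
have j0 : (0 < j)%N by apply: pos_k En _.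
have edge x y := @p_edge_fibers mu p n n' x y j p_pr mu0 n0 j0 En.
have nedge : p_edges_on p (gamma mu @` [set` M]) (n, n').
  by split=> //; split=> //; exists j.
case: (suff_M p p_pr n n' nedge) => full; last first.
  have [] : p_edges_on p [set` M] (m0, m1).
    by apply: full; split=> //; apply: edge.
  by move=> _ [/= m0M']; rewrite m0M' in m0M.
apply: (ltP p m01) => x y xM Ex Ey xy.
have y0 : (0 < y)%N.
  by case: y Ey {xy} => // Ey; rewrite -Ey /gamma div0n in n'0.
have [] : p_edges_on p [set` M] (x, y).
  by apply: full; split=> //; apply: edge => //; apply: M_pos.
by move=> _ [].
Qed.

(** * Sums of cyclic modules *)

(** The generators and the basis are expressed in terms of each other by square
integer matrices. One of their products is the identity, hence so is the
other. *)
Lemma zbasis_gen_free (V : zmodType) (d : nat) (e g : 'I_d -> V) :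
  zbasis [set: V] e ->
  (forall x, exists c : 'I_d -> int, x = \sum_i g i *~ c i) ->
  forall c : 'I_d -> int, \sum_i g i *~ c i = 0 -> forall i, c i = 0.
Proof.
move=> [eT e_inj] g_gen c c0.
have e_gen x : exists k : 'I_d -> int, x = \sum_i e i *~ k i.
  by have : [set: V] x by []; rewrite eT => -[k _ <-]; exists k.
have [C Ce] := choice (fun i => g_gen (e i)).
have [E Eg] := choice (fun i => e_gen (g i)).
have e_free (k k' : 'I_d -> int) :
    \sum_i e i *~ k i = \sum_i e i *~ k' i -> k =1 k'.
  move=> kk'; have /ffunP ff : [ffun i => k i] = [ffun i => k' i].
    apply: e_inj; rewrite (eq_bigr (fun i => e i *~ k i)) => [|i _].
      2: by rewrite ffunE.
    by rewrite kk'; apply: eq_bigr => i _; rewrite ffunE.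
  by move=> i; have := ff i; rewrite !ffunE.
have swap (k : 'I_d -> int) :
    \sum_i g i *~ k i = \sum_j e j *~ \sum_i (k i * E i j).
  rewrite (eq_bigr (fun i => \sum_j e j *~ (k i * E i j))) => [|i _].
    by rewrite exchange_big /=; apply: eq_bigr => j _; rewrite mulrz_sumr.
  by rewrite Eg mulrz_suml; apply: eq_bigr => j _; rewrite mulrC mulrzA.
pose MC := \matrix_(i, j) C i j; pose ME := \matrix_(i, j) E i j.
have CE1 : MC *m ME = 1%:M.
  apply/matrixP => i j; rewrite !mxE.
  rewrite (eq_bigr (fun k => C i k * E k j)) => [|k _]; last by rewrite !mxE.
  apply: (e_free (fun j => \sum_k C i k * E k j) (fun j => (i == j)%:R)).
  rewrite -swap -Ce (bigD1 i) //= eqxx big1 ?addr0 // => k ki.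
  by rewrite eq_sym (negPf ki).
have cE0 : (\row_i c i) *m ME = 0.
  apply/rowP => j; rewrite !mxE.
  rewrite (eq_bigr (fun k => c k * E k j)) => [|k _]; last by rewrite !mxE.
  apply: (e_free (fun j => \sum_k c k * E k j) (fun=> 0)).
  by rewrite -swap c0 big1.
have /rowP c_0 : \row_i c i = 0.
  by rewrite -[LHS]mulmx1 -(mulmx1C CE1) mulmxA cE0 mul0mx.
by move=> i; have := c_0 i; rewrite !mxE.
Qed.

Lemma zbasis_direct_sum (V : zmodType) (L : set V) (n : nat) (b : 'I_n -> V) :
  zbasis L b -> direct_sum L (fun j => [set b j *~ c | c in [set: int]]).
Proof.
move=> [-> b_inj]; split=> [|y z yb zb yz].
  apply/seteqP; split=> x.
    move=> [c _ <-]; exists [ffun j => b j *~ c j] => [j|].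
      by rewrite ffunE; exists (c j).
    by apply: eq_bigr => j _; rewrite ffunE.
  move=> [y yb ->]; have /choice[c Ec] : forall j, exists c, b j *~ c = y j.
  by move=> j; have [a _ <-] := yb j; exists a.
  exists [ffun j => c j] => //; apply: eq_bigr => j _.
  by rewrite ffunE Ec.
have /choice[c Ec] : forall j, exists c, b j *~ c = y j.
  by move=> j; have [a _ <-] := yb j; exists a.
have /choice[k Ek] : forall j, exists c, b j *~ c = z j.
  by move=> j; have [a _ <-] := zb j; exists a.
have /ffunP ck : [ffun j => c j] = [ffun j => k j].
  apply: b_inj; transitivity (\sum_j y j).
    by apply: eq_bigr => j _; rewrite ffunE; case: (Ec j).
  by rewrite yz; apply: eq_bigr => j _; rewrite ffunE Ek.
apply/ffunP => j; have := ck j; rewrite !ffunE.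
by rewrite -Ec -Ek => ->.
Qed.

Lemma char_poly_tr (R : comNzRingType) n (A : 'M[R]_n) :
  char_poly A^T = char_poly A.
Proof.
rewrite /char_poly -[RHS]det_tr; congr (\det _).
by apply/matrixP => i j; rewrite !mxE eq_sym.
Qed.

Definition ffun_poly d (c : {ffun 'I_d -> int}) : {poly int} :=
  \poly_(j < d) (if insub j is Some k then c k else 0).

Lemma size_ffun_poly d (c : {ffun 'I_d -> int}) : (size (ffun_poly c) <= d)%N.
Proof. exact: size_poly. Qed.

Lemma coef_ffun_poly d (c : {ffun 'I_d -> int}) (k : 'I_d) :
  (ffun_poly c)`_k = c k.
Proof. by rewrite coef_poly ltn_ord valK. Qed.

Lemma ffun_poly_inj d : injective (@ffun_poly d).
Proof. by move=> c c' E; apply/ffunP => k; rewrite -!coef_ffun_poly E. Qed.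

Section CyclicSum.
Variables (V : comNzRingType) (s : V) (h : {additive V -> V}).
Hypothesis hE : forall x, h x = s * x.

Definition int_horner : {poly int} -> V := horner_eval s \o map_poly intr.
HB.instance Definition _ := GRing.RMorphism.on int_horner.

Lemma int_hornerX : int_horner 'X = s.
Proof. by rewrite /int_horner /= map_polyX /horner_eval hornerX. Qed.

Lemma int_hornerC c : int_horner c%:P = c%:~R.
Proof. by rewrite /int_horner /= map_polyC /horner_eval hornerC. Qed.

Lemma int_horner_coef n (f : {poly int}) : (size f <= n)%N ->
  int_horner f = \sum_(j < n) s ^+ j *~ f`_j.
Proof.
move=> sf; rewrite -{1}(coefK f) poly_def rmorph_sum /=.
rewrite (big_ord_widen n (fun j => int_horner (f`_j *: 'X^j)) sf).
rewrite [RHS](bigID (fun j : 'I_n => (j < size f)%N)) /=.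
rewrite [X in _ = _ + X]big1 ?addr0 => [|j]; last first.
  by rewrite -leqNgt => fj; rewrite nth_default.
apply: eq_bigr => j _; rewrite -mul_polyC rmorphM rmorphXn /=.
by rewrite int_hornerC int_hornerX mulrC mulrzr.
Qed.

Lemma iter_hE n x : iter n h x = s ^+ n * x.
Proof. by elim: n => [|n IHn] /=; rewrite ?mul1r // hE IHn mulrA exprS. Qed.

Variables (r : nat) (b : 'I_r -> V) (p : 'I_r -> {poly int}).
Hypothesis p_monic : forall i, p i \is monic.
Hypothesis p_gt1 : forall i, (1 < size (p i))%N.
Hypothesis p_ann : forall i, int_horner (p i) * b i = 0.
Hypothesis b_gen : forall x, exists f : 'I_r -> {poly int},
  x = \sum_i int_horner (f i) * b i.
Hypothesis V_rank : zlattice [set: V] (\sum_i (size (p i)).-1).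

Definition cyclic_span i : set V :=
  [set int_horner f * b i | f in [set: {poly int}]].

Lemma int_horner_rmodp i f :
  int_horner f * b i = int_horner (Pdiv.Ring.rmodp f (p i)) * b i.
Proof.
rewrite {1}(Pdiv.RingMonic.rdivp_eq (p_monic i) f) rmorphD rmorphM /= mulrDl.
by rewrite -mulrA p_ann mulr0 add0r.
Qed.

Lemma size_rmodp i f : (size (Pdiv.Ring.rmodp f (p i)) <= (size (p i)).-1)%N.
Proof.
by rewrite -ltnS -polySpred ?Pdiv.Ring.ltn_rmodpN0 ?monic_neq0.
Qed.

(** Division by the p i shows that the elements s^j * b i with j < deg (p i)
generate V. Their number is the rank of V, so they are a basis. *)
Lemma cyclic_sum_free (f : 'I_r -> {poly int}) :
  (forall i, (size (f i) <= (size (p i)).-1)%N) ->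
  \sum_i int_horner (f i) * b i = 0 -> forall i, f i = 0.
Proof.
move=> sf f0; pose d i := (size (p i)).-1.
pose T := {i : 'I_r & 'I_(d i)}.
have cardT : #|{: T}| = (\sum_i d i)%N.
  rewrite -sum1_card (eq_bigr (fun i => \sum_(j < d i) 1)%N) => [|i _].
    by rewrite (sig_big_dep _ _ (fun i (j : 'I_(d i)) => 1%N)).
  by rewrite sum1_card card_ord.
pose g (t : T) := s ^+ tagged t * b (tag t).
have sumT (k : forall i, 'I_(d i) -> int) :
    \sum_i (\sum_(j < d i) s ^+ j *~ k i j) * b i
      = \sum_(t : T) g t *~ k (tag t) (tagged t).
  pose F i (j : 'I_(d i)) := (s ^+ j * b i) *~ k i j.
  rewrite (eq_bigr (fun i => \sum_(j < d i) F i j)) => [|i _].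
    by rewrite (sig_big_dep _ _ F).
  by rewrite mulr_suml; apply: eq_bigr => j _; rewrite mulrzAl.
move: V_rank; rewrite -[X in zlattice _ X]/(\sum_i d i)%N -cardT.
move=> [e e_basis].
have enumT (k : T -> int) :
    \sum_(i < #|{: T}|) g (enum_val i) *~ k (enum_val i)
    = \sum_(t : T) g t *~ k t.
  by rewrite -(big_enum_val (fun t => g t *~ k t)).
have g_gen x :
    exists c : 'I_#|{: T}| -> int, x = \sum_i g (enum_val i) *~ c i.
  have [k Ek] := b_gen x.
  pose k' i (j : 'I_(d i)) := (Pdiv.Ring.rmodp (k i) (p i))`_j.
  exists (fun t => k' (tag (enum_val t)) (tagged (enum_val t))).
  rewrite (enumT (fun t => k' (tag t) (tagged t))) -sumT Ek.
  apply: eq_bigr => i _.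
  by rewrite int_horner_rmodp (int_horner_coef (size_rmodp i _)).
have g_free := zbasis_gen_free e_basis g_gen.
pose c (t : T) := (f (tag t))`_(tagged t).
have c0 : \sum_(i < #|{: T}|) g (enum_val i) *~ c (enum_val i) = 0.
  rewrite (enumT c) -(sumT (fun i j => (f i)`_j)) -[RHS]f0.
  by apply: eq_bigr => i _; rewrite (int_horner_coef (sf i)).
move=> i; apply/polyP => j; rewrite coef0.
have [lt_jd|le_dj] := ltnP j (d i); last first.
  by rewrite nth_default // (leq_trans (sf i)).
pose t : T := Tagged (fun i => 'I_(d i)) (Ordinal lt_jd).
by have := g_free _ c0 (enum_rank t); rewrite enum_rankK.
Qed.

Lemma cyclic_zbasis i :
  zbasis (cyclic_span i) (fun j : 'I_(size (p i)).-1 => s ^+ j * b i).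
Proof.
pose d := (size (p i)).-1.
have PE (c : {ffun 'I_d -> int}) :
    \sum_(j < d) (s ^+ j * b i) *~ c j = int_horner (ffun_poly c) * b i.
  rewrite (int_horner_coef (size_ffun_poly c)) mulr_suml.
  by apply: eq_bigr => j _; rewrite mulrzAl coef_ffun_poly.
split=> [|c c' /=].
  apply/seteqP; split=> x; last first.
    by move=> [c _ <-]; rewrite PE; exists (ffun_poly c).
  move=> [f _ <-]; rewrite int_horner_rmodp.
  exists [ffun j : 'I_d => (Pdiv.Ring.rmodp f (p i))`_j] => //.
  rewrite (int_horner_coef (size_rmodp i f)) mulr_suml; apply: eq_bigr => j _.
  by rewrite ffunE mulrzAl.
rewrite !PE => cc'.
pose f k := if k == i then ffun_poly c - ffun_poly c' else 0.
have /(_ i) : forall k, f k = 0.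
  apply: cyclic_sum_free => [k|].
    rewrite /f; case: eqP => [->|_]; last by rewrite size_poly0.
    rewrite (leq_trans (size_polyD _ _)) // geq_max size_polyN.
    by rewrite !size_ffun_poly.
  rewrite (bigD1 i) //= big1 => [|k ki].
    2: by rewrite /f (negPf ki) rmorph0 mul0r.
  by rewrite /f eqxx rmorphB mulrBl /= cc' subrr addr0.
by rewrite /f eqxx => /eqP; rewrite subr_eq0 => /eqP /ffun_poly_inj.
Qed.

Lemma cyclic_direct_sum : direct_sum [set: V] cyclic_span.
Proof.
split=> [|y z yb zb yz].
  apply/seteqP; split=> // x _; have [f ->] := b_gen x.
  exists [ffun i => int_horner (f i) * b i] => [i|].
    by rewrite ffunE; exists (f i).
  by apply: eq_bigr => i _; rewrite ffunE.
have /choice[f Ef] : forall i, exists f, int_horner f * b i = y i.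
  by move=> i; have [f _ <-] := yb i; exists f.
have /choice[f' Ef'] : forall i, exists f, int_horner f * b i = z i.
  by move=> i; have [f' _ <-] := zb i; exists f'.
pose k i := Pdiv.Ring.rmodp (f i - f' i) (p i).
have k0 : forall i, k i = 0.
  apply: cyclic_sum_free => [i|]; first exact: size_rmodp.
  rewrite (eq_bigr (fun i => y i - z i)) => [|i _].
    by rewrite sumrB yz subrr.
  by rewrite -int_horner_rmodp rmorphB mulrBl /= Ef Ef'.
apply/ffunP => i; apply/eqP; rewrite -subr_eq0 -Ef -Ef' -mulrBl -rmorphB.
by rewrite int_horner_rmodp -/(k i) k0 rmorph0 mul0r.
Qed.

Lemma cyclic_char_poly i : lattice_char_poly (cyclic_span i) h (p i).
Proof.
pose d := (size (p i)).-1; have d0 : (0 < d)%N by rewrite -ltnS prednK // ltnW.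
exists d, (fun j => s ^+ j * b i), (companionmx (p i))^T; split.
- exact: cyclic_zbasis.
- move=> j; rewrite hE mulrA -exprS.
  (* the image of the last basis vector is read off from p i, which is monic and
     kills b i; the other basis vectors are shifted *)
  have [jd|jd] := eqVneq (nat_of_ord j) d.-1.
    rewrite jd prednK //.
    rewrite (eq_bigr (fun k : 'I_d => (s ^+ k * b i) *~ - (p i)`_k)) => [|k _].
      have : int_horner (p i) * b i = 0 by [].
      have sp : (size (p i) <= d.+1)%N by rewrite prednK // ltnW.
      rewrite (int_horner_coef sp) big_ord_recr /=.
      have /monicP := p_monic i; rewrite lead_coefE => ->.
      rewrite mulr1z mulrDl addrC => /eqP; rewrite addr_eq0 => /eqP ->.
      rewrite mulr_suml -sumrN; apply: eq_bigr => k _.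
      by rewrite mulrNz mulrzAl.
    by rewrite !mxE jd eqxx.
  have jd1 : (j.+1 < d)%N.
    rewrite ltn_neqAle ltn_ord andbT; apply: contraNneq jd => Ej.
    exact/eqP/(congr1 predn Ej).
  rewrite (bigD1 (Ordinal jd1)) //= big1 => [|k kj]; last first.
    rewrite !mxE (negPf jd) (_ : _ == _ = false) ?mulr0z //.
    by apply: contraNF kj => /eqP jk; apply/eqP/val_inj.
  by rewrite !mxE (negPf jd) /= eqxx mulr1z addr0.
- by rewrite char_poly_tr companionmxK.
Qed.

Lemma cyclic_orlik_block i : (exists2 N : nat, (0 < N)%N & s ^+ N = 1) ->
  orlik_block (cyclic_span i) h.
Proof.
move=> [N N0 sN]; pose d := (size (p i)).-1.
have d0 : (0 < d)%N by rewrite -ltnS prednK // ltnW.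
have hL n x : cyclic_span i x -> cyclic_span i (s ^+ n * x).
  move=> [f _ <-]; exists ('X^n * f) => //.
  by rewrite rmorphM rmorphXn /= int_hornerX mulrA.
split.
- exists d, (b i); split=> //.
  + by exists (fun j => s ^+ j * b i); apply: cyclic_zbasis.
  + by move=> _ [x Lx <-]; rewrite hE -[s]expr1; apply: hL.
  + by exists 1 => //; rewrite rmorph1 mul1r.
  rewrite (_ : (fun j => _)
    = (fun j : 'I_d => [set (s ^+ j * b i) *~ c | c in [set: int]])).
    by apply: zbasis_direct_sum; apply: cyclic_zbasis.
  by apply/funext => j; rewrite iter_hE.
- have sK : cancel ( *%R s) ( *%R (s ^+ N.-1)).
    by move=> x; rewrite mulrA -exprSr prednK // sN mul1r.
  split.
  + by move=> x /= Lx; rewrite hE -[s]expr1; apply: hL.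
  + by move=> x y _ _; rewrite !hE => /(can_inj sK).
  + move=> x Lx /=; exists (s ^+ N.-1 * x); first exact: hL.
    by rewrite hE mulrA -exprS prednK // sN mul1r.
- by exists N => // x _; rewrite iter_hE sN mul1r.
Qed.

End CyclicSum.

(** * Quotients of Z[t] *)

Section IntegralQuotient.
Variable P : {poly int}.
Hypotheses (P_monic : P \is monic) (P_gt1 : (1 < size P)%N).

Lemma mk_monic_id : mk_monic P = P.
Proof. by rewrite /mk_monic P_gt1 P_monic. Qed.

Lemma in_qpoly_divides x y : divides P (x - y) -> in_qpoly P x = in_qpoly P y.
Proof.
move=> [q E]; apply/eqP; rewrite -subr_eq0 -rmorphB /= E.
apply/eqP/val_inj; rewrite /= mk_monic_id.
by rewrite Pdiv.RingMonic.rmodp_mull.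
Qed.

Lemma in_qpolyK (x : {poly %/ P}) : in_qpoly P (val x) = x.
Proof. by apply/val_inj; rewrite /= Pdiv.Ring.rmodp_small // size_mk_monic. Qed.

Lemma int_horner_in_qpoly mu f :
  int_horner ('qX ^+ mu : {poly %/ P}) f = in_qpoly P (f \Po 'X^mu).
Proof.
rewrite /int_horner /= /horner_eval [in RHS]/comp_poly -horner_map /=.
rewrite -map_poly_comp rmorphXn; congr (_.[_]); apply: eq_map_poly => c /=.
by rewrite -[c in RHS]intz rmorph_int rmorph_int.
Qed.

Lemma qpoly_zlattice : zlattice [set: {poly %/ P}]%classic (size P).-1.
Proof.
set d := (size P).-1; have Ed : size P = d.+1 by rewrite prednK // ltnW.
have in_small (x : {poly int}) : (size x <= d)%N -> val (in_qpoly P x) = x.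
  by move=> sx; apply: in_qpoly_small; rewrite mk_monic_id Ed ltnS.
have QE (c : {ffun 'I_d -> int}) :
    \sum_(k < d) ('qX : {poly %/ P}) ^+ k *~ c k = in_qpoly P (ffun_poly c).
  rewrite /ffun_poly poly_def rmorph_sum /=; apply: eq_bigr => k _.
  rewrite valK -mul_polyC rmorphM rmorphXn /= -[c k in RHS]intz.
  by rewrite !rmorph_int mulrzl.
exists (fun k : 'I_d => 'qX ^+ k); split.
  apply/seteqP; split=> // x _; exists [ffun k : 'I_d => (val x)`_k] => //.
  rewrite QE -[RHS]in_qpolyK; congr (in_qpoly P _); apply/polyP => k.
  rewrite coef_poly; case: ltnP => [kd|dk].
    by rewrite insubT ffunE.
  rewrite nth_default // (leq_trans _ dk) // -ltnS -Ed.
  apply: leq_trans (size_mk_monic x) (eq_leq _).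
  by rewrite mk_monic_id.
move=> c c' /=; rewrite !QE => /(congr1 val).
by rewrite !in_small ?size_ffun_poly // => /ffun_poly_inj.
Qed.

End IntegralQuotient.

(** * The decomposition *)

Local Open Scope fset_scope.

Theorem theorem6p2 (M : {fset nat}) (M_pos : forall m : nat, m \in M -> (0 < m)%N)
    (M_neq0 : M != fset0) (mu : nat) (mu_pos : (0 < mu)%N) :
  sdiOb_sufficient M mu ->
  has_standard_orlik_decomposition (iter mu (@Or_monodromy M)).
Proof.
move=> suff_M; have mu0 := mu_pos.
pose PM := cyclotomic_prod M.
have PM_monic : PM \is monic by apply: monic_prod_Cyclotomic.
have sPM : (size PM).-1 = (\sum_(m <- M) totient m)%N.
  rewrite /PM /cyclotomic_prod size_monic_prod_pred => [|m _].
    2: exact: Cyclotomic_monic.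
  by apply: eq_bigr => m _; rewrite size_Cyclotomic.
have PM_gt1 : (1 < size PM)%N.
  have [m mM] := fset0Pn _ M_neq0.
  rewrite -ltn_predRL sPM (bigD1_seq m) ?fset_uniq //=.
  by rewrite addn_gt0 totient_gt0 M_pos.
pose N := undup [seq gamma mu m | m <- M].
have N_uniq : uniq N := undup_uniq _.
have memN m : m \in M -> gamma mu m \in N.
  by move=> mM; rewrite mem_undup; apply: map_f.
have NP n : n \in N -> exists2 m, m \in M & gamma mu m = n.
  by rewrite mem_undup => /mapP[m mM ->]; exists m.
have N_pos n : n \in N -> (0 < n)%N.
  by move=> /NP[m mM <-]; rewrite gamma_gt0 ?M_pos.
pose r := fiber_rank M mu; pose R := (\max_(n <- N) r n)%N.
have PME : PM = \prod_(n <- N) fiber_poly M mu n by apply: big_fibers.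
have cP : {in N, forall n, 'Phi_n \Po 'X^mu
    = fiber_poly M mu n * fiber_cofactor M mu n :> {poly int}}.
  by move=> n /N_pos; apply: fiber_polyM.
have Pr : {in N, forall n, powers_span mu (fiber_poly M mu n) (r n)}.
  by move=> n _; apply: powers_span_prod_Cyclotomic.
have uP : {in N &, forall n n', n != n' -> (r n' <= r n)%N ->
    comaximal (fiber_cofactor M mu n) (fiber_poly M mu n')}.
  by move=> n n' /NP ? /NP ?; apply: comaximal_fibers.
have [B BP] : exists B : nat -> {poly {poly int}}, forall k,
    [/\ B k \is monic, size (B k) = k.+1
      & divides PM (((\prod_(n <- N | (k < r n)%N) 'Phi_n) \Po 'X^mu)
          * pow_eval mu (B k))].
  rewrite PME; exact: powers_span_annihilated_basis N_uniq cP Pr uP.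
have PM_spans : powers_span mu PM R.
  rewrite PME; apply: powers_span_prod N_uniq cP Pr uP _ => n nN.
  exact: leq_bigmax_seq.
pose p (k : 'I_R) : {poly int} := \prod_(n <- N | (k < r n)%N) 'Phi_n.
pose b (k : 'I_R) : Or M := in_qpoly PM (pow_eval mu (B k)).
pose s : Or M := 'qX ^+ mu.
have p_monic k : p k \is monic by apply: monic_prod_Cyclotomic.
have sp k : (size (p k)).-1 = (\sum_(n <- N | (k < r n)%N) totient n)%N.
  rewrite size_monic_prod_pred => [|m _]; last exact: Cyclotomic_monic.
  by apply: eq_bigr => m _; rewrite size_Cyclotomic.
have p_gt1 k : (1 < size (p k))%N.
  rewrite -ltn_predRL sp lt0n; apply/negP => /eqP sum0.
  have := ltn_ord k; rewrite ltnNge => /negP; apply.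
  apply/bigmax_leqP_seq => n nN _; rewrite leqNgt; apply/negP => kn.
  have := sum0.
  rewrite -big_filter (bigD1_seq n) ?filter_uniq ?mem_filter ?kn //=.
  by move/eqP; rewrite addn_eq0 eqn0Ngt totient_gt0 N_pos.
have hE x : iter mu (@Or_monodromy M) x = s * x.
  rewrite /s; elim: (mu) => [|j IHj] /=; first by rewrite expr0 mul1r.
  by rewrite IHj exprS -mulrA.
have p_ann k : int_horner s (p k) * b k = 0.
  rewrite int_horner_in_qpoly -rmorphM /= -(rmorph0 (in_qpoly PM)).
  by apply: in_qpoly_divides; rewrite ?subr0 //; case: (BP k).
have b_gen x :
    exists f : 'I_R -> {poly int}, x = \sum_k int_horner s (f k) * b k.
  have [F sF PF] := PM_spans (val x).
  have B_monic k : (k < R)%N -> B k \is monic /\ size (B k) = k.+1.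
    by case: (BP k).
  have [f Ef] := monic_family_gen B_monic sF.
  exists f; rewrite -[LHS]in_qpolyK (in_qpoly_divides PM_monic PM_gt1 PF) Ef.
  rewrite !rmorph_sum /=; apply: eq_bigr => k _.
  by rewrite pow_evalZ rmorphM /= int_horner_in_qpoly.
have V_rank : zlattice [set: Or M]%classic (\sum_k (size (p k)).-1).
  rewrite (_ : (\sum_k _)%N = (size PM).-1); first exact: qpoly_zlattice.
  (* Phi_n divides the r n polynomials p k with k < r n, and r n * totient n is
     the degree of fiber_poly n *)
  rewrite sPM (eq_bigr _ (fun k _ => sp k)).
  rewrite (exchange_big_dep predT) //=.
  rewrite [RHS](big_fibers _ _ (f := gamma mu) N_uniq memN).
  apply: eq_big_seq => n nN; rewrite -fiber_rankM // -/(r n).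
  rewrite -(big_ord_widen _ (fun=> totient n)) ?sum_nat_const ?card_ord //.
  exact: leq_bigmax_seq.
exists R, (cyclic_span s b); split.
- exact: (cyclic_direct_sum p_monic p_ann b_gen V_rank).
- move=> k; apply: (cyclic_orlik_block hE p_monic p_gt1 p_ann b_gen V_rank).
  pose L := (\prod_(m <- M) m)%N.
  have L0 : (0 < L)%N.
    by rewrite /L big_seq_cond; apply: prodn_cond_gt0 => m /andP[/M_pos].
  exists L => //; rewrite /s exprAC.
  have -> : 'qX ^+ L = 1 :> Or M; last by rewrite expr1n.
  rewrite -rmorphXn -(rmorph1 (in_qpoly PM)) /=; apply: in_qpoly_divides => //.
  rewrite -prod_Cyclotomic // (bigID (mem M)) /=.
  rewrite big_mem_sub ?fset_uniq ?divisors_uniq //.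
    by exists (\prod_(m <- divisors L | m \notin M) 'Phi_m); rewrite mulrC.
  move=> m mM; rewrite -dvdn_divisors // /L (bigD1_seq m) ?fset_uniq //=.
  exact: dvdn_mulr.
- exists p => [k|k k' kk'].
    exact: (cyclic_char_poly hE p_monic p_gt1 p_ann b_gen V_rank).
  exists (\prod_(n <- N | (k < r n)%N && ~~ (k' < r n)%N) 'Phi_n).
  rewrite /p (bigID (fun n => (k' < r n)%N)) mulrC /=; congr (_ * _).
  by apply: eq_bigl => n; rewrite andb_idl // kk' => /ltnW.
Qed.
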